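(* Let $\mathcal{A}$ be a polynomially-ambiguous weighted automaton satisfying the standing assumptions in the context. If $\mathcal{A}$ is pumpable then it is unambiguisable, and if $\mathcal{A}$ is blindly pumpable then it is determinisable.
   Context: A weighted automaton (over $\mathbb{Q}$) is a tuple $\mathcal{A}=(Q,\Sigma,M,I,F)$ with $Q$ a finite nonempty set of states, $\Sigma$ a finite alphabet, $M:\Sigma\to\mathbb{Q}^{Q\times Q}$, and $I,F\in\mathbb{Q}^Q$. For $w=a_1\cdots a_n$ put $M(w)=M(a_1)\cdots M(a_n)$, with $M(\epsilon)$ the identity matrix, and $\mathcal{A}(w)=I^T M(w) F$. The size $|\mathcal{A}|$ is the number $|Q|$ of states. Two automata over $\Sigma$ are equivalent if they give the same value to every word of $\Sigma^*$. A path on $w=a_1\cdots a_n$ is a sequence of states $q_1,\dots,q_{n+1}$ with $M(a_i)_{q_i,q_{i+1}}\neq 0$ for all $i$; it is a run if moreover $I(q_1)\neq 0$ and $F(q_{n+1})\neq 0$. $\mathcal{A}$ is deterministic if $I$ has at most one non-zero entry and, for every $a\in\Sigma$, every row of $M(a)$ has at most one non-zero entry; unambiguous if every word has at most one run; polynomially-ambiguous if there is a polynomial $\mathfrak{p}$ such that every word $w\in\Sigma^*$ has at most $\mathfrak{p}(|w|)$ runs. $\mathcal{A}$ is unambiguisable (resp. determinisable) if it is equivalent to some unambiguous (resp. deterministic) weighted automaton over $\mathbb{Q}$. Standing assumptions on $\mathcal{A}$: all entries of $I$, $F$ and $M(a)$ ($a\in\Sigma$) are integers; $M(a)_{p,q}\geq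 0$ for all $a\in\Sigma$, $p,q\in Q$ (entries of $I,F$ may be negative); every state lies on some run (i.e. is reachable from a state $p$ with $I(p)\ne0$ and can reach a state $r$ with $F(r)\neq 0$). A square matrix $N$ is p-triangular if there is a permutation matrix $P$ with $PNP^{-1}$ upper triangular. $\mathbb{N}$ contains $0$. $\mathcal{A}$ is pumpable if for all $u,v,w\in\Sigma^*$ such that $M(v)$ is p-triangular there is a diagonal entry $d$ of $M(v)$ with $\mathcal{A}(uv^{|\mathcal{A}|+n}w)=d^n\cdot\mathcal{A}(uv^{|\mathcal{A}|}w)$ for every $n\in\mathbb{N}$. $\mathcal{A}$ is blindly pumpable if for all $u,v\in\Sigma^*$ such that $M(v)$ is p-triangular there is a diagonal entry $d$ of $M(v)$ with $\mathcal{A}(uv^{|\mathcal{A}|+n}w)=d^n\cdot\mathcal{A}(uv^{|\mathcal{A}|}w)$ for every $w\in\Sigma^*$ and $n\in\mathbb{N}$. *)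

(* Defs.v *)
From mathcomp Require Import all_boot all_order all_algebra.

Set Implicit Arguments.
Unset Strict Implicit.
Unset Printing Implicit Defensive.

Import Order.TTheory GRing.Theory Num.Theory.
Local Open Scope ring_scope.

(* The states are numbered: the state set is 'I_(wa_size A). *)
Record wautomaton (Sigma : finType) := WAutomaton {
  wa_size : nat;
  wa_size_gt0 : (0 < wa_size)%N;
  wa_trans : Sigma -> 'M[rat]_wa_size;
  wa_init : 'cV[rat]_wa_size;
  wa_final : 'cV[rat]_wa_size
}.

Definition wpow (Sigma : finType) (v : seq Sigma) (k : nat) : seq Sigma :=
  flatten (nseq k v).

Definition wmat (Sigma : finType) (A : wautomaton Sigma) (w : seq Sigma) :
    'M[rat]_(wa_size A) :=
  \prod_(a <- w) wa_trans A a.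

Definition wvalue (Sigma : finType) (A : wautomaton Sigma) (w : seq Sigma) : rat :=
  ((wa_init A)^T *m wmat A w *m wa_final A) 0 0.

Definition equivalent (Sigma : finType) (A B : wautomaton Sigma) : Prop :=
  forall w : seq Sigma, wvalue A w = wvalue B w.

(* With 0-based indices, letter i of w is read from position i of the state
   sequence (widen_ord) to position i + 1 (lift ord0). *)
Definition is_path (Sigma : finType) (A : wautomaton Sigma) (w : seq Sigma)
    (q : (size w).+1.-tuple 'I_(wa_size A)) : bool :=
  [forall i : 'I_(size w),
    wa_trans A (tnth (in_tuple w) i)
      (tnth q (widen_ord (leqnSn (size w)) i)) (tnth q (lift ord0 i)) != 0].

Definition is_run (Sigma : finType) (A : wautomaton Sigma) (w : seq Sigma)
    (q : (size w).+1.-tuple 'I_(wa_size A)) : bool :=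
  [&& is_path q, wa_init A (tnth q ord0) 0 != 0
    & wa_final A (tnth q ord_max) 0 != 0].

Definition nb_runs (Sigma : finType) (A : wautomaton Sigma) (w : seq Sigma) : nat :=
  #|[set q : (size w).+1.-tuple 'I_(wa_size A) | is_run q]|.

Definition deterministic (Sigma : finType) (A : wautomaton Sigma) : Prop :=
  (#|[set q | (wa_init A q 0 != 0)%R]| <= 1)%N /\
  forall (a : Sigma) (p : 'I_(wa_size A)),
    (#|[set q | (wa_trans A a p q != 0)%R]| <= 1)%N.

Definition unambiguous (Sigma : finType) (A : wautomaton Sigma) : Prop :=
  forall w : seq Sigma, (nb_runs A w <= 1)%N.

Definition polynomially_ambiguous (Sigma : finType) (A : wautomaton Sigma) : Prop :=
  exists p : {poly rat},
    forall w : seq Sigma, (nb_runs A w)%:R <= p.[(size w)%:R].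

Definition unambiguisable (Sigma : finType) (A : wautomaton Sigma) : Prop :=
  exists B : wautomaton Sigma, unambiguous B /\ equivalent A B.

Definition determinisable (Sigma : finType) (A : wautomaton Sigma) : Prop :=
  exists B : wautomaton Sigma, deterministic B /\ equivalent A B.

Definition integral (Sigma : finType) (A : wautomaton Sigma) : Prop :=
  [/\ forall q, wa_init A q 0 \is a Num.int,
      forall q, wa_final A q 0 \is a Num.int
    & forall a p q, wa_trans A a p q \is a Num.int].

Definition nonneg_trans (Sigma : finType) (A : wautomaton Sigma) : Prop :=
  forall a p q, 0 <= wa_trans A a p q.

Definition trim (Sigma : finType) (A : wautomaton Sigma) : Prop :=
  forall q : 'I_(wa_size A),
    exists (w : seq Sigma) (r : (size w).+1.-tuple 'I_(wa_size A)),
      is_run r /\ q \in r.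

(* is_trig_mx means lower triangular, whence the transpose. *)
Definition p_triangular (n : nat) (N : 'M[rat]_n) : Prop :=
  exists P : 'M[rat]_n, is_perm_mx P /\ is_trig_mx (P *m N *m invmx P)^T.

Definition pumpable (Sigma : finType) (A : wautomaton Sigma) : Prop :=
  forall u v w : seq Sigma, p_triangular (wmat A v) ->
    exists i : 'I_(wa_size A), forall n : nat,
      wvalue A (u ++ wpow v (wa_size A + n)%N ++ w) =
      (wmat A v i i) ^+ n * wvalue A (u ++ wpow v (wa_size A) ++ w).

Definition blindly_pumpable (Sigma : finType) (A : wautomaton Sigma) : Prop :=
  forall u v : seq Sigma, p_triangular (wmat A v) ->
    exists i : 'I_(wa_size A), forall (w : seq Sigma) (n : nat),
      wvalue A (u ++ wpow v (wa_size A + n)%N ++ w) =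
      (wmat A v i i) ^+ n * wvalue A (u ++ wpow v (wa_size A) ++ w).

(* Main.v *)
(* Call a set of vectors closed if it is a finite union of subspaces. The closure
   W_1 u ... u W_r of the orbit {I^T M(u)} is stable: each letter maps each W_i
   into some W_j. If a word v loops on W_i and is
   bijective there, blind pumpability puts every orbit vector of W_i in one of
   finitely many eigenspaces of M(v), so by density M(v) is a scalar on W_i. By
   Ramsey's theorem every long word has a factor whose support is transitive and
   which loops on the W_i; the polynomial ambiguity makes it p-triangular. Such
   factors can be cancelled up to a scalar, so only finitely many maps between the
   W_i of maximal dimension D arise up to scalars, and if D >= 2 the orbit lies in
   finitely many subspaces of dimension < D, contradicting density. Hence (modulo the
   unobservable vectors) the W_i are lines, and they are the states of a
   deterministic automaton.

   In the pumpable case, let Z_1 u ... u Z_s be the closure of {M(w) F}. For fixed u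
   and v, the diagonal entry of M(v) that governs u v^n w depends, by density, only
   on the component of M(w) F. Annotating each letter with the component of the
   remaining suffix, computed from right to left, therefore makes the automaton
   blindly pumpable. A deterministic automaton for the annotated words becomes
   unambiguous when the annotation is erased, as each word has only one correct
   annotation. *)
From HB Require Import structures.
Require Import Defs.
From mathcomp Require Import all_boot all_order all_algebra fingroup perm.
From mathcomp Require Import zify.
From Stdlib Require Import Classical.

Set Implicit Arguments.
Unset Strict Implicit.
Unset Printing Implicit Defensive.

Import Order.TTheory GRing.Theory Num.Theory.
Local Open Scope ring_scope.

(** * Linear hulls of orbits *)

Section LinearHull.
Variables (K : fieldType) (V : vectType K).
Implicit Types (R : V -> Prop) (U W : {vspace V}) (X : seq {vspace V}).

Definition covers X R W :=
  forall x, R x -> x \in W -> exists2 U, U \in X & x \in U.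

(* Density of [R] in [W] for the topology whose closed sets are the finite unions of
   subspaces. *)
Definition dense R W :=
  forall X, covers X R W -> exists2 U, U \in X & (W <= U)%VS.

(** Induction on the dimension: if [R] is not dense in [W], it has a cover there none of whose
    members contains [W], so each of them meets [W] in a smaller subspace. *)
Lemma linear_hull R W :
  exists2 X, covers X R W & forall U, U \in X -> dense R U.
Proof.
have [n] := ubnP (\dim W); elim: n W => // n IHn W /ltnSE-leWn.
have [dW|ndW] := classic (dense R W).
  exists [:: W] => [x _ Wx|U]; first by exists W; rewrite ?mem_head.
  by rewrite inE => /eqP->.
have [X nX] := not_all_ex_not _ _ ndW.
have [covX noX] := imply_to_and _ _ nX.
have [Y covY dY] : exists2 Y : seq {vspace V}, (forall x, R x -> x \in W ->
      (exists2 U, U \in X & x \in U) -> exists2 U, U \in Y & x \in U)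
    & forall U, U \in Y -> dense R U.
  elim: X noX {nX covX} => [|U X IHX] noX; first by exists [::] => // x _ _ [].
  have [|Y covY dY] := IHX.
    by case=> U' XU' leWU'; apply: noX; exists U'; rewrite // inE XU' orbT.
  have ltUW : (\dim (U :&: W) < \dim W)%N.
    rewrite ltn_neqAle dimvS ?capvSr // andbT; apply/negP => /eqP eqUW.
    apply: noX; exists U; rewrite ?mem_head //.
    have /eqP WU : (U :&: W == W)%VS by rewrite eqEdim capvSr eqUW leqnn.
    by rewrite -WU capvSl.
  have [Z covZ dZ] := IHn _ (leq_trans ltUW leWn).
  exists (Z ++ Y) => [x Rx Wx [U']|U']; last by rewrite mem_cat => /orP[/dZ|/dY].
  rewrite inE => /orP[/eqP->|XU'] U'x.
    have [|U1 ZU1 U1x] := covZ x Rx; first by rewrite memv_cap U'x.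
    by exists U1; rewrite // mem_cat ZU1.
  have [|U1 YU1 U1x] := covY x Rx Wx; first by exists U'.
  by exists U1; rewrite // mem_cat YU1 orbT.
by exists Y => // x Rx Wx; apply: covY => //; apply: covX.
Qed.

Section Action.
Variables (G : finType) (g : G -> 'End(V)) (x0 : V).

(** The first letter acts first, as for row vectors multiplied on the right; column vectors fit this
    convention once words are reversed. *)
Fixpoint act (w : seq G) : 'End(V) :=
  if w is a :: w' then (act w' \o g a)%VF else \1%VF.

Lemma act_cat u w : act (u ++ w) = (act w \o act u)%VF.
Proof. by elim: u => [|a u IHu] /=; rewrite ?comp_lfun1r // IHu comp_lfunA. Qed.

Lemma act_catE u w x : act (u ++ w) x = act w (act u x).
Proof. by rewrite act_cat lfunE. Qed.

Definition in_orbit (x : V) := exists w, x = act w x0.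

(** The orbit is stable under [g a], so the preimages of the components under [g a] cover it, and
    density puts each [W i] inside one of them. *)
Lemma orbit_hull : exists (r : nat) (W : 'I_r -> {vspace V}) (i0 : 'I_r)
    (del : 'I_r -> G -> 'I_r),
  [/\ x0 \in W i0, forall i a, (g a @: W i <= W (del i a))%VS
    & forall i, dense in_orbit (W i)].
Proof.
have [X covX dX] := linear_hull in_orbit fullv.
have [|U0 XU0 U0x0] := covX x0 _ (memvf _); first by exists [::]; rewrite id_lfunE.
pose W (i : 'I_(size X)) : {vspace V} := nth 0%VS X i.
have WP U : U \in X -> exists i, W i = U.
  by move=> XU; have ltUX := XU; rewrite -index_mem in ltUX;
     exists (Ordinal ltUX); rewrite /W /= nth_index.
have [i0 Wi0] := WP _ XU0.
(* The default [i] is never taken: density shows below that some [j] qualifies. *)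
pose del i a := odflt i [pick j | (g a @: W i <= W j)%VS].
exists (size X), W, i0, del; split=> [|i a|i]; first by rewrite Wi0.
  rewrite /del; case: pickP => //= noj.
  have [|U /mapP[U' XU' ->]] :=
    dX (W i) (mem_nth _ (ltn_ord i)) [seq (g a @^-1: U)%VS | U <- X].
    move=> _ [w ->] _; have [||U XU Ux] := covX (g a (act w x0)).
    - by exists (rcons w a); rewrite -cats1 act_catE /= comp_lfun1l.
    - exact: memvf.
    by exists (g a @^-1: U)%VS; rewrite ?map_f // -memv_preim.
  have [j <-] := WP _ XU' => /limgS/subv_trans leW; have /idP[] := noj j.
  by apply: leW; apply/subvP=> _ /memv_imgP[x Wx ->]; rewrite memv_preim.
exact/dX/mem_nth.
Qed.

End Action.
End LinearHull.
(** * Ramsey's theorem for triangles *)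

Section Ramsey.
Local Open Scope nat_scope.
Variable C : finType.

Lemma pigeonhole (T : Type) (f : T -> C) (s : seq T) n :
  #|C| * n < size s -> exists k, n < size [seq y <- s | f y == k].
Proof.
move=> lt_s; apply: NNPP => /not_ex_all_not small; move: lt_s.
have -> : size s = \sum_k size [seq y <- s | f y == k].
  elim: s {small} => [|y s IHs] /=; first by rewrite big1.
  rewrite (bigD1 (f y)) //= eqxx /= addSn IHs (bigD1 (f y)) //=.
  by congr (_ + _).+1; apply: eq_bigr => k; rewrite eq_sym => /negPf->.
rewrite ltnNge -sum_nat_const => /negP[]; apply: leq_sum => k _.
by rewrite leqNgt; apply/negP/small.
Qed.

(** Induction on the number of allowed colours. By pigeonhole, many vertices are joined to the first
    vertex [x] by one colour [k]; either two of them are joined by [k], which closes a triangle, or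
    [k] no longer occurs among them. *)
Lemma ramsey_triangle_in n : exists N, forall (S : {set C}) (col : nat -> nat -> C)
    (s : seq nat), #|S| <= n -> sorted ltn s -> N <= size s ->
    (forall i j, i \in s -> j \in s -> i < j -> col i j \in S) ->
  exists i j k, [/\ i < j < k, k \in s, col i j = col j k & col i j = col i k].
Proof.
elim: n => [|n [N IHn]].
  exists 2 => S col [|i [|j s]] //= S0 /andP[ltij _] _ colS.
  have := colS i j; rewrite !inE !eqxx orbT ltij => /(_ isT isT isT) Sc.
  by move: S0; rewrite leqn0 cards_eq0 => /eqP S0; rewrite S0 inE in Sc.
exists (#|C| * N).+2 => S col [|x s] //= leS s_sorted lt_s colS.
have [k lt_k] := pigeonhole (col x) lt_s.
set s' := filter _ _ in lt_k.
have ltx y : y \in s -> x < y.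
  by move=> sy; apply: (allP (order_path_min ltn_trans s_sorted)).
have s's y : y \in s' -> y \in s by rewrite mem_filter => /andP[].
have colk y : y \in s' -> col x y = k by rewrite mem_filter => /andP[/eqP].
have [[i [j [s'i s'j ltij colij]]]|nk] := classic (exists i j,
    [/\ i \in s', j \in s', i < j & col i j = k]).
  exists x, i, j; rewrite ltij ltx ?s's // inE s's ?orbT //.
  by rewrite colij !colk.
have [|||i j s'i s'j ltij|i [j [l [lts s'l e1 e2]]]] := IHn (S :\ k) col s'.
- have Sk : k \in S.
    case: s' lt_k s's colk {nk} => //= y s' _ s's colk.
    rewrite -(colk y) ?mem_head // colS ?mem_head ?ltx ?s's ?mem_head //.
    by rewrite inE s's ?mem_head ?orbT.
  by rewrite (cardsD1 k S) Sk in leS.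
- by apply: sorted_filter (path_sorted s_sorted); apply: ltn_trans.
- exact: ltnW.
- rewrite !inE colS ?inE ?s's ?orbT // andbT; apply/eqP => colij.
  by apply: nk; exists i, j.
by exists i, j, l; rewrite inE s's ?orbT.
Qed.

Lemma ramsey_triangle : exists N, forall col : nat -> nat -> C,
  exists i j k, [/\ i < j < k, k < N, col i j = col j k & col i j = col i k].
Proof.
have [N ramN] := ramsey_triangle_in #|C|; exists N => col.
have [|||//|i [j [k]]] := ramN setT col (iota 0 N).
- exact: max_card.
- exact: iota_ltn_sorted.
- by rewrite size_iota.
by rewrite mem_iota; exists i, j, k.
Qed.
End Ramsey.
(** * Pumping on the hull *)

Arguments wpow : simpl never.

Lemma wpowSr (S : finType) (v : seq S) n : wpow v n.+1 = wpow v n ++ v.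
Proof.
elim: n => [|n IHn]; first by rewrite /wpow /= cats0.
by rewrite -[LHS]/(v ++ wpow v n.+1) {1}IHn catA.
Qed.

Lemma dim_limg_le (K : fieldType) (V U : vectType K) (f : 'Hom(V, U)) (W : {vspace V}) :
  (\dim (f @: W) <= \dim W)%N.
Proof. by rewrite -(limg_ker_dim f W) leq_addl. Qed.

Section Pumping.
Variables (K : fieldType) (V : vectType K) (G C : finType).
Variables (g : G -> 'End(V)) (x0 : V) (c : seq G -> C) (m : nat).
Hypothesis pump : forall v v' : seq G, v != [::] -> c v = c v' -> c (v ++ v') = c v ->
  exists ds : seq K, forall u, exists2 d, d \in ds
    & act g (u ++ wpow v m.+1) x0 = d *: act g (u ++ wpow v m) x0.

Variables (r : nat) (W : 'I_r -> {vspace V}) (i0 : 'I_r) (del : 'I_r -> G -> 'I_r).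
Hypotheses (Wx0 : x0 \in W i0) (Wdel : forall i a, (g a @: W i <= W (del i a))%VS).
Hypothesis Wdense : forall i, dense (in_orbit g x0) (W i).

Lemma act_hull w i : (act g w @: W i <= W (foldl del i w))%VS.
Proof.
elim: w i => [|a w IHw] i /=; first by rewrite lim1g.
by rewrite limg_comp (subv_trans _ (IHw _)) ?limgS.
Qed.

(** The scalars [ds] serve all prefixes [u] at once, so the finitely many kernels [U d] cover the
    orbit and density puts [W i] in one of them. As [v] maps [W i] onto itself, every vector of
    [W i] is an image under the [m]-th power of [v], which removes the power. *)
Lemma loop_scalar v v' i : v != [::] -> c v = c v' -> c (v ++ v') = c v ->
  (act g v @: W i)%VS = W i -> exists d, {in W i, forall x, act g v x = d *: x}.
Proof.
move=> v_n0 cv cvv' vW; have [ds dsP] := pump v_n0 cv cvv'.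
pose U d := lker (act g (wpow v m.+1) - d *: act g (wpow v m)).
have [|_ /mapP[d _ ->] /eqlfun_inP WU] := Wdense (i := i) (X := [seq U d | d <- ds]).
  move=> _ [w ->] _.
  have [d ds_d dE] := dsP w; exists (U d); first exact: map_f.
  by apply/eqlfunP; rewrite scale_lfunE -!act_catE.
have vmW n : (act g (wpow v n) @: W i)%VS = W i.
  by elim: n => [|n IHn]; rewrite ?lim1g // wpowSr act_cat limg_comp IHn.
exists d => y; rewrite -{1}(vmW m) => /memv_imgP[x Wx ->].
by rewrite -act_catE -wpowSr WU // scale_lfunE.
Qed.

Variable D : nat.
Hypothesis leWD : forall i, (\dim (W i) <= D)%N.

Lemma full_img f i j : (f @: W i <= W j)%VS -> \dim (f @: W i) = D -> (f @: W i)%VS = W j.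
Proof. by move=> fWj fD; apply/eqP; rewrite eqEdim fWj fD leWD. Qed.

(** Colour two positions of [s] by the colour of the factor between them and the components reached
    at both. A monochromatic triangle yields a factor [v] looping on a component; maximal rank makes
    the loop surjective, so [v] is a scalar there and can be cut out. *)
Lemma full_rank_finite : exists N, forall s i, \dim (act g s @: W i) = D ->
  exists t d, (size t < N)%N /\ {in W i, forall x, act g s x = d *: act g t x}.
Proof.
have [N ramN] := ramsey_triangle (C * 'I_r * 'I_r)%type; exists N => s i.
have [n] := ubnP (size s); elim: n s => // n IHn s /ltnSE-les sD.
have [lt_sN|le_Ns] := ltnP (size s) N.
  by exists s, 1; split=> // x _; rewrite scale1r.
pose st k := foldl del i (take k s).
have [k1 [k2 [k3 [/andP[lt12 lt23] lt3N]]]] :=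
  ramN (fun j k => (c (take (k - j) (drop j s)), st j, st k)).
set s1 := take k1 s; set v := take (k2 - k1) (drop k1 s).
set v' := take (k3 - k2) (drop k2 s); set s2 := drop k2 s.
have le12 := ltnW lt12; have le23 := ltnW lt23.
have s1v : s1 ++ v = take k2 s by rewrite -takeD subnKC.
have defs : s = s1 ++ v ++ s2 by rewrite catA s1v cat_take_drop.
have vv' : v ++ v' = take (k3 - k1) (drop k1 s).
  have -> : (k3 - k1 = (k2 - k1) + (k3 - k2))%N.
    by rewrite addnC addnBA // subnK.
  by rewrite takeD drop_drop subnK.
case=> cv st12 _ [cvv' _]; rewrite -vv' in cvv'.
have sz_v : size v = (k2 - k1)%N.
  rewrite size_takel // size_drop leq_sub2r //.
  by rewrite (leq_trans le23) // (leq_trans (ltnW lt3N)).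
have v_n0 : v != [::] by rewrite -size_eq0 sz_v subn_eq0 -ltnNge.
have s1W : (act g s1 @: W i)%VS = W (st k1).
  apply: full_img (act_hull _ _) _; apply/eqP; rewrite eqn_leq.
  rewrite (leq_trans (dimvS (act_hull _ _))) //= -sD defs act_cat limg_comp.
  exact: dim_limg_le.
have s1vW : (act g (s1 ++ v) @: W i)%VS = W (st k1).
  rewrite st12 /st -s1v.
  apply: full_img (act_hull _ _) _; apply/eqP; rewrite eqn_leq.
  rewrite (leq_trans (dimvS (act_hull _ _))) //= -sD defs catA act_cat limg_comp.
  exact: dim_limg_le.
have [|d dP] := loop_scalar v_n0 cv (esym cvv') (i := st k1).
  by rewrite -{1}s1W -limg_comp -act_cat.
have sE : {in W i, forall x, act g s x = d *: act g (s1 ++ s2) x}.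
  move=> x Wx; rewrite defs !act_catE dP ?linearZ //.
  by rewrite -s1W memv_img.
have [||t [d' [lt_t tE]]] := IHn (s1 ++ s2).
- apply: leq_trans les; rewrite defs !size_cat ltn_add2l.
  by rewrite -[ltnLHS]add0n ltn_add2r lt0n size_eq0.
- apply/eqP; rewrite eqn_leq (leq_trans (dimvS (act_hull _ _))) //= -sD.
  apply/dimvS/subvP=> _ /memv_imgP[x Wx ->].
  by rewrite sE // memvZ // memv_img.
exists t, (d * d'); split=> // x Wx.
by rewrite sE // tE // scalerA.
Qed.

Lemma hull_dim_drop : (1 < D)%N -> forall i, (\dim (W i) < D)%N.
Proof.
move=> D_gt1 i; rewrite ltn_neqAle leWD andbT; apply/eqP => WiD.
have [N finN] := full_rank_finite.
pose words := flatten [seq [seq tval t | t : k.-tuple G] | k <- iota 0 N].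
have wordsP t : (size t < N)%N -> t \in words.
  move=> lt_t; apply/flatten_mapP; exists (size t); first by rewrite mem_iota.
  by apply/imageP; exists (in_tuple t).
pose bases := <[x0]>%VS :: [seq (g a @: W j)%VS | j <- enum 'I_r, a <- enum G].
pose small := [seq U <- [seq W j | j <- enum 'I_r] ++
  [seq (act g t @: B)%VS | t <- words, B <- bases] | (\dim U < D)%N].
have [|U] := Wdense (X := small) (i := i); last first.
  rewrite mem_filter => /andP[ltUD _] /dimvS; rewrite WiD leqNgt ltUD //.
move=> _ [w ->] _.
(* If the last component has dimension [D], cut [w] after its last letter of rank below [D], or at
   the start if there is none. Then [B] is the image under that letter, or the line of [x0], which
   is small because [1 < D]; the rest [s] has full rank and acts like a short word up to a
   scalar. *)
suff [ltWD|[B [k [s [bB ltBD Bk sD xB]]]]] : (\dim (W (foldl del i0 w)) < D)%N \/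
    exists B k s, [/\ B \in bases, (\dim B < D)%N, (B <= W k)%VS,
      (act g s @: W k)%VS = W (foldl del i0 w) /\ \dim (act g s @: W k) = D
      & act g w x0 \in (act g s @: B)%VS].
- exists (W (foldl del i0 w)); last by rewrite (subvP (act_hull _ _)) ?memv_img.
  by rewrite mem_filter ltWD mem_cat map_f ?mem_enum.
- have [t [d [lt_t tE]]] := finN _ _ sD.2.
  exists (act g t @: B)%VS.
    rewrite mem_filter mem_cat (leq_ltn_trans (dim_limg_le _ _) ltBD) andTb.
    by apply/orP; right; apply/allpairsP; exists (t, B); split=> //; apply: wordsP.
  have /memv_imgP[x Bx ->] := xB.
  by rewrite tE ?(subvP Bk) // memvZ // memv_img.
elim/last_ind: w => [|w a IHw].
  have [ltWD|leDW] := ltnP (\dim (W i0)) D; [by left | right].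
  have WD : \dim (W i0) = D by apply/eqP; rewrite eqn_leq leWD.
  exists <[x0]>%VS, i0, [::]; rewrite mem_head /= lim1g -memvE lim1g id_lfunE memv_line.
  by rewrite dim_vline (leq_ltn_trans _ D_gt1) ?leq_b1.
rewrite -cats1 foldl_cat /= act_catE /= comp_lfun1l.
set j := foldl _ _ w in IHw *.
have [ltWD|leDW] := ltnP (\dim (W (del j a))) D; [by left | right].
have WjaD : \dim (W (del j a)) = D by apply/eqP; rewrite eqn_leq leWD.
have [ltgD|] := ltnP (\dim (g a @: W j)) D.
  exists (g a @: W j)%VS, (del j a), [::].
  rewrite /= !lim1g ltgD Wdel WjaD memv_img ?(subvP (act_hull _ _)) ?memv_img //.
  split=> //; rewrite inE; apply/orP; right; apply/allpairsP.
  by exists (j, a); split=> //; rewrite mem_enum.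
move=> leDg; have gD : \dim (g a @: W j) = D.
  by apply/eqP; rewrite eqn_leq leDg (leq_trans (dimvS (Wdel _ _))).
have WjD : \dim (W j) = D.
  by apply/eqP; rewrite eqn_leq leWD -gD dim_limg_le.
case: IHw => [|[B [k [s [bB ltBD Bk [sW sD] xB]]]]]; first by rewrite WjD ltnn.
exists B, k, (rcons s a); rewrite -cats1 act_cat /= comp_lfun1l !limg_comp sW.
by rewrite (full_img (Wdel j a) gD) memv_img.
Qed.

End Pumping.

(** * Orbits contained in finitely many lines *)

Fixpoint run_weight (K : fieldType) (G : finType) (I : Type) (del : I -> G -> I)
    (s : I -> G -> K) (i : I) (w : seq G) : K :=
  if w is a :: w' then s i a * run_weight del s (del i a) w' else 1.

Section Lines.
Variables (K : fieldType) (V : vectType K) (G C : finType).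
Variables (g : G -> 'End(V)) (x0 : V) (c : seq G -> C) (m : nat).

(** With [D] the maximal dimension, [hull_dim_drop] leaves only [D <= 1]. Each component is then
    spanned by one vector [b i], possibly zero, and a letter sends it to a multiple of another
    [b j]. *)
Lemma pumping_lines :
  (forall v v' : seq G, v != [::] -> c v = c v' -> c (v ++ v') = c v ->
    exists ds : seq K, forall u, exists2 d, d \in ds
      & act g (u ++ wpow v m.+1) x0 = d *: act g (u ++ wpow v m) x0) ->
  exists (r : nat) (i0 : 'I_r) (del : 'I_r -> G -> 'I_r) (s : 'I_r -> G -> K)
    (t : K) (b : 'I_r -> V),
  forall w, act g w x0 = (t * run_weight del s i0 w) *: b (foldl del i0 w).
Proof.
move=> pump; have [r [W [i0 [del [Wx0 Wdel Wdense]]]]] := orbit_hull g x0.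
have dimW1 i : (\dim (W i) <= 1)%N.
  pose D := \max_j \dim (W j).
  have leWD j : (\dim (W j) <= D)%N by apply: (@leq_bigmax _ (fun j => \dim (W j))).
  apply: leq_trans (leWD i) _; rewrite leqNgt; apply/negP => D_gt1.
  have ltWD := hull_dim_drop pump Wx0 Wdel Wdense leWD D_gt1.
  have : (D <= D.-1)%N.
    by apply/bigmax_leqP => j _; rewrite -ltnS prednK ?(ltnW D_gt1).
  by rewrite leqNgt prednK ?leqnn // ltnW.
pose b i := vpick (W i).
have Wb i x : x \in W i -> exists k, x = k *: b i.
  move=> Wx; apply/vlineP; have [W0|W_n0] := eqVneq (W i) 0%VS.
    by move: Wx; rewrite W0 memv0 => /eqP->; apply: mem0v.
  suff /eqP-> : <[b i]>%VS == W i by [].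
  by rewrite eqEdim -memvE memv_pick dim_vline vpick0 W_n0 dimW1.
have [t tE] := Wb _ _ Wx0.
have [s sE] : exists s, forall i a, g a (b i) = s i a *: b (del i a).
  have step (ia : 'I_r * G) : exists k, g ia.2 (b ia.1) = k *: b (del ia.1 ia.2).
    by apply: Wb; rewrite (subvP (Wdel _ _)) ?memv_img ?memv_pick.
  have [s sE] := fin_all_exists step.
  by exists (fun i a => s (i, a)) => i a; apply: (sE (i, a)).
exists r, i0, del, s, t, b => w; rewrite {1}tE linearZ /= -scalerA; congr (_ *: _).
elim: w (i0) => [|a w IHw] i /=; first by rewrite id_lfunE scale1r.
by rewrite comp_lfunE sE linearZ /= IHw scalerA.
Qed.

End Lines.

(** * Factoring out the unobservable vectors *)

Section Machine.
Variables (K : fieldType) (V : vectType K) (G C : finType).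
Variables (g : G -> 'End(V)) (x0 : V) (c : seq G -> C) (m : nat).
Variables (U : vectType K) (f : 'Hom(V, U)).

(** Starting from the whole space, intersect with kernels of [f] composed with [act g w] as long as
    this lowers the dimension. *)
Lemma unobservable_subspace : exists N : {vspace V},
  forall x, x \in N <-> forall w, f (act g w x) = 0.
Proof.
suff gen n (N : {vspace V}) : (\dim N < n)%N ->
    (forall x, (forall w, f (act g w x) = 0) -> x \in N) ->
    exists N : {vspace V}, forall x, x \in N <-> forall w, f (act g w x) = 0.
  by apply: (gen _ fullv (ltnSn _)) => x _; rewrite memvf.
elim: n N => // n IHn N /ltnSE-leNn obsN.
have [[w wN]|Nw] := classic (exists w, ~~ (N <= lker (f \o act g w))%VS).
  apply: IHn (N :&: lker (f \o act g w))%VS _ _ => [|x obsx].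
    apply: leq_trans leNn; rewrite ltn_neqAle dimvS ?capvSl // andbT.
    apply: contra wN => /eqP eqN; apply/capv_idPl/eqP.
    by rewrite eqEdim capvSl eqN leqnn.
  by rewrite memv_cap obsN // memv_ker comp_lfunE obsx eqxx.
exists N => x; split=> [Nx w|]; last exact: obsN.
apply/eqP; rewrite -comp_lfunE -memv_ker; apply: subvP x Nx.
by apply/negPn/negP => wN; apply: Nw; exists w.
Qed.

(** Pumping is known only after applying [f], for all continuations [w], that is, modulo
    unobservable vectors. Projecting these away turns it into the vector equation that
    [pumping_lines] asks for. *)
Lemma pumping_machine :
  (forall v v' : seq G, v != [::] -> c v = c v' -> c (v ++ v') = c v ->
    exists ds : seq K, forall u, exists2 d, d \in ds & forall w,
      f (act g (u ++ wpow v m.+1 ++ w) x0) = d *: f (act g (u ++ wpow v m ++ w) x0)) ->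
  exists (r : nat) (i0 : 'I_r) (del : 'I_r -> G -> 'I_r) (s : 'I_r -> G -> K)
    (t : K) (b : 'I_r -> U),
  forall w, f (act g w x0) = (t * run_weight del s i0 w) *: b (foldl del i0 w).
Proof.
move=> pump; have [N NP] := unobservable_subspace.
pose pi : 'End(V) := (\1 - projv N)%VF.
have piE x : pi x = x - projv N x by rewrite add_lfunE opp_lfunE id_lfunE.
have pi0 x : x \in N -> pi x = 0 by move=> Nx; rewrite piE projv_id ?subrr.
have subpi x : x - pi x \in N by rewrite piE opprB addrC subrK memv_proj.
have fpi x : f (pi x) = f x.
  have := (NP _).1 (subpi x) [::]; rewrite /= id_lfunE linearB => /eqP.
  by rewrite subr_eq0 => /eqP.
(* [pi] realises the quotient by the unobservable subspace inside [V]. *)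
pose h a : 'End(V) := (pi \o g a)%VF.
(* Letters preserve [N], so projecting after every letter amounts to projecting once at the end. *)
have act_h w x : act h w (pi x) = pi (act g w x).
  elim: w x => [|a w IHw] x /=; first by rewrite !id_lfunE.
  rewrite !comp_lfunE -IHw; congr (act h w _); apply/esym/eqP.
  rewrite -subr_eq0 -!linearB; apply/eqP/pi0/NP => w'.
  by have /NP/(_ (a :: w')) := subpi x; rewrite /= comp_lfunE.
have [|r [i0 [del [s [t [b bE]]]]]] := @pumping_lines K V G C h (pi x0) c m.
  move=> v v' v_n0 cv cvv'; have [ds dsP] := pump v v' v_n0 cv cvv'.
  exists ds => u; have [d ds_d dE] := dsP u; exists d => //.
  rewrite !act_h; apply/eqP; rewrite -subr_eq0 -linearZ -linearB.
  by apply/eqP/pi0/NP => w; rewrite !linearB !linearZ /= -!act_catE -!(catA u) dE scalerN subrr.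
exists r, i0, del, s, t, (f \o b) => w.
by rewrite -fpi -act_h bE linearZ.
Qed.
End Machine.
(** * Polynomial ambiguity and p-triangularity *)

Lemma sqrn_lt_exp2 k : (4 < k -> k * k < 2 ^ k)%N.
Proof.
elim: k => // k IHk; rewrite ltnS leq_eqVlt => /predU1P[<-//|k_gt4].
rewrite expnS mul2n -addnn (leq_trans _ (leq_add (IHk k_gt4) (ltnW (IHk k_gt4)))) //.
have : (5 * k <= k * k)%N by rewrite leq_mul2r k_gt4 orbT.
lia.
Qed.

Lemma poly_lt_exp2 (p : {poly rat}) : exists n, p.[n%:R] < (2 ^ n)%:R.
Proof.
pose S := \sum_(i < size p) `|p`_i|; pose c := Num.bound S; pose d := size p.
have S_ge0 : 0 <= S by apply: sumr_ge0.
have ltS : S < (2 ^ c)%:R.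
  have := archi_boundP S_ge0; rewrite -/c => /lt_trans; apply.
  by rewrite ltr_nat ltn_expl.
(* At [x = 2 ^ k] the bound is [S * x ^ d < 2 ^ (c + k * d) <= 2 ^ (k * k) <= 2 ^ (2 ^ k)]; the
   summand 5 is there for [sqrn_lt_exp2]. *)
pose k := (c + d + 5)%N; exists (2 ^ k)%N; set x := _%:R : rat.
have x_ge1 : 1 <= x by rewrite ler1n expn_gt0.
have le_p : p.[x] <= S * x ^+ d.
  rewrite horner_coef mulr_suml; apply: ler_sum => i _.
  apply: le_trans (ler_norm _) _; rewrite normrM ler_wpM2l //.
  rewrite ger0_norm ?exprn_ge0 ?(le_trans ler01) //.
  by apply: ler_weXn2l => //; apply: ltnW.
apply: le_lt_trans le_p _; apply: lt_le_trans (_ : (2 ^ c)%:R * x ^+ d <= _).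
  by rewrite ltr_pM2r // exprn_gt0 // (lt_le_trans ltr01).
rewrite -natrX -natrM ler_nat -expnM -expnD leq_exp2l //.
have k_gt4 : (4 < k)%N by rewrite /k ltn_addl.
apply: leq_trans (ltnW (sqrn_lt_exp2 k_gt4)).
have {3}-> : k = (d + (c + 5))%N by rewrite /k addnCA addnA.
by rewrite mulnDr addnC leq_add2l (leq_trans (leq_addr 5 c)) ?leq_pmull // ltnW.

Qed.

Section Triangular.
Variables (n : nat) (N : 'M[rat]_n).
Hypothesis N_trans : forall p q r, N p q != 0 -> N q r != 0 -> N p r != 0.
Hypothesis N_anti : forall p q, N p q != 0 -> N q p != 0 -> p = q.

(** The support is an order up to reflexivity, and listing the indices by decreasing size of their
    up-sets is a linear extension of it. *)
Lemma p_triangular_of_order : p_triangular N.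
Proof.
case: n N N_trans N_anti => [|n'] N' N'_trans N'_anti.
  exists 1%:M; split; last by apply/is_trig_mxP => -[].
  by apply/is_perm_mxP; exists 1%g; rewrite perm_mx1.
pose up p := [set q | (q == p) || (N' p q != 0)].
have ltup p q : p != q -> N' p q != 0 -> (#|up q| < #|up p|)%N.
  move=> neq_pq Npq; apply/proper_card/properP; split.
    apply/subsetP => r; rewrite !inE => /predU1P[->|Nqr]; first by rewrite Npq orbT.
    by rewrite (N'_trans p q r) ?orbT.
  exists p; rewrite !inE ?eqxx // negb_or neq_pq.
  by apply: contra neq_pq => /(N'_anti _ _ Npq)->.
pose s := sort (fun p q => #|up q| <= #|up p|)%N (enum 'I_n'.+1).
have sz_s : size s = n'.+1 by rewrite size_sort size_enum_ord.
have s_uniq : uniq s by rewrite sort_uniq enum_uniq.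
have s_inj : injective (fun i : 'I_n'.+1 => nth ord0 s i).
  by move=> i j /eqP; rewrite nth_uniq ?sz_s // => /eqP/val_inj.
have s_sorted (i j : 'I_n'.+1) : (i < j)%N ->
    (#|up (nth ord0 s j)| <= #|up (nth ord0 s i)|)%N.
  apply: (sorted_ltn_nth (leT := fun p q => #|up q| <= #|up p|)%N); rewrite ?inE ?sz_s //.
    by move=> p q r leqp ler; apply: leq_trans leqp.
  by apply: sort_sorted => p q; apply: leq_total.
exists (perm_mx (perm s_inj)); split; first exact: perm_mx_is_perm.
apply/is_trig_mxP => i j ltij.
rewrite -[invmx _]/(_^-1) -perm_mxV -row_permE -col_permE !mxE !permE.
apply/eqP/negPn/negP => Nji; have := s_sorted i j ltij; rewrite leqNgt => /negP[].
apply: ltup Nji; rewrite nth_uniq ?sz_s //.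
by rewrite gtn_eqF.
Qed.
End Triangular.

(** * Paths, ambiguity and supports of words *)

Section Paths.
Variables (Sigma : finType) (A : wautomaton Sigma).
Local Notation Q := 'I_(wa_size A).
Implicit Types (p q : Q) (u v w : seq Sigma) (s t : seq Q).

(** The start [p] is kept apart from the later states [s], so that [s] has the length of [w] and
    paths concatenate along with words. *)
Fixpoint apath p w s : bool :=
  match w, s with
  | a :: w', q :: s' => (wa_trans A a p q != 0) && apath q w' s'
  | [::], [::] => true
  | _, _ => false
  end.

Lemma size_apath p w s : apath p w s -> size s = size w.
Proof. by elim: w p s => [|a w IHw] p [|q s] //= /andP[_ /IHw->]. Qed.

Lemma apath_cat p w s v t : size s = size w ->
  apath p (w ++ v) (s ++ t) = apath p w s && apath (last p s) v t.
Proof. by elim: w p s => [|a w IHw] p [|q s] //= [/IHw->]; rewrite andbA. Qed.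

Lemma apath_nth a0 p w s : size s = size w ->
  apath p w s = all (fun k => wa_trans A (nth a0 w k) (nth p (p :: s) k)
    (nth p (p :: s) k.+1) != 0) (iota 0 (size w)).
Proof.
elim: w p s => [|a w IHw] p [|q s] //= [sz_s].
rewrite (iotaDl 1 0) all_map (IHw _ _ sz_s); congr (_ && _).
apply: eq_in_all => k; rewrite mem_iota /= => ltk.
rewrite !add0n in ltk *; rewrite (set_nth_default q p (s := s)) ?sz_s //.
by rewrite (set_nth_default q p (s := q :: s)) //= ltnS sz_s ltnW.
Qed.

Lemma is_run_cons w (r : (size w).+1.-tuple Q) p s : val r = p :: s ->
  is_run r = [&& apath p w s, wa_init A p 0 != 0 & wa_final A (last p s) 0 != 0].
Proof.
move=> rE; have sz_s : size s = size w by have := size_tuple r; rewrite rE => -[].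
rewrite /is_run !(tnth_nth p) rE /= -[in nth p _ (size w)]sz_s -last_nth.
congr (_ && _); case: w r rE sz_s => [|a0 w] r rE sz_s.
  by case: s sz_s {rE} => //= _; apply/forallP => -[].
rewrite (apath_nth a0) //; apply/forallP/allP => [r_path k | r_path k].
  rewrite mem_iota /= => ltk; have := r_path (Ordinal ltk).
  by rewrite !(tnth_nth p) (tnth_nth a0) rE.
have := r_path k; rewrite mem_iota ltn_ord => /(_ isT).
by rewrite !(tnth_nth p) (tnth_nth a0) rE.
Qed.

Lemma nb_runs_ge w (L : seq (seq Q)) : uniq L ->
  (forall s, s \in L -> exists p t, [/\ s = p :: t, apath p w t, wa_init A p 0 != 0
    & wa_final A (last p t) 0 != 0]) -> (size L <= nb_runs A w)%N.
Proof.
move=> L_uniq L_run; pose T := (size w).+1.-tuple Q.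
have /(uniq_leq_size _) : {subset pmap (insub : seq Q -> option T) L
    <= enum [set r : T | is_run r]}.
  move=> r; rewrite mem_pmap_sub mem_enum inE => /L_run[p [t [rE w_t Ip Ft]]].
  by rewrite (is_run_cons rE) w_t Ip.
rewrite pmap_sub_uniq // -cardE => /(_ isT); apply: leq_trans.
rewrite size_pmap_sub (_ : count _ L = size L) //; apply/eqP; rewrite -all_count.
apply/allP => s /L_run[p [t [-> /size_apath<- _ _]]] /=.
by rewrite eqxx.
Qed.

Lemma wmat_cat u v : wmat A (u ++ v) = wmat A u *m wmat A v.
Proof. by rewrite /wmat big_cat. Qed.

Lemma wmat_cons a v : wmat A (a :: v) = wa_trans A a *m wmat A v.
Proof. by rewrite /wmat big_cons. Qed.

Lemma wmat_nil : wmat A [::] = 1%:M.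
Proof. by rewrite /wmat big_nil. Qed.

Lemma apath_of_wmat v p q : wmat A v p q != 0 -> exists2 s, apath p v s & last p s = q.
Proof.
elim: v p => [|a v IHv] p.
  rewrite wmat_nil mxE; case: (eqVneq p q) => [<- _|_]; last by rewrite eqxx.
  by exists [::].
rewrite wmat_cons mxE => sum_n0.
have [r] : exists r, wa_trans A a p r * wmat A v r q != 0.
  apply/existsP; apply: contraNT sum_n0 => /existsPn all0.
  by rewrite big1 // => r _; apply/eqP/negbNE/all0.
rewrite mulf_eq0 negb_or => /andP[a_pr /IHv[s v_s <-]].
by exists (r :: s); rewrite //= a_pr.
Qed.

Lemma wmat_ge0 v p q : nonneg_trans A -> 0 <= wmat A v p q.
Proof.
move=> A_ge0; elim: v p => [|a v IHv] p; first by rewrite wmat_nil mxE ler0n.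
by rewrite wmat_cons mxE sumr_ge0 // => r _; rewrite mulr_ge0.
Qed.

(** Nonnegative terms cannot cancel, so supports compose like relations. *)
Lemma wmat_cat_neq0 u v p q r : nonneg_trans A ->
  wmat A u p q != 0 -> wmat A v q r != 0 -> wmat A (u ++ v) p r != 0.
Proof.
move=> A_ge0 u_pq v_qr; rewrite wmat_cat mxE (bigD1 q) //= gt_eqF //.
apply: ltr_wpDr; first by apply: sumr_ge0 => i _; rewrite mulr_ge0 ?wmat_ge0.
by rewrite mulr_gt0 // lt_def ?u_pq ?v_qr wmat_ge0.
Qed.

(** Each copy of [v] can be read along either loop; the equal lengths of the loops keep the
    concatenations distinct. *)
Lemma wpow_loops p v s s' n : apath p v s -> apath p v s' -> last p s = p ->
    last p s' = p -> s != s' ->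
  exists L, [/\ uniq L, size L = (2 ^ n)%N
    & forall t, t \in L -> apath p (wpow v n) t /\ last p t = p].
Proof.
move=> v_s v_s' s_p s'_p neq_ss'; elim: n => [|n [L [L_uniq L_sz L_loop]]].
  by exists [:: [::]]; split=> // t /[1!inE] /eqP->.
have szs t : t \in [:: s; s'] -> apath p v t /\ last p t = p.
  by rewrite !inE => /orP[] /eqP->.
exists [seq x ++ y | x <- [:: s; s'], y <- L]; split.
- apply: allpairs_uniq => //; first by rewrite /= inE neq_ss'.
  move=> [x y] [x' y'] /allpairsP[[x1 y1] [sx _ [-> ->]]].
  move=> /allpairsP[[x2 y2] [sx' _ [-> ->]]] /eqP /=.
  have [v_x _] := szs _ sx; have [v_x' _] := szs _ sx'.
  by rewrite eqseq_cat ?(size_apath v_x) ?(size_apath v_x') // => /andP[/eqP-> /eqP->].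
- by rewrite size_allpairs L_sz expnS.
move=> _ /allpairsP[[x y] [/= xs yL ->]].
have [v_x x_p] := szs x xs; have [vn_y y_p] := L_loop y yL.
rewrite last_cat x_p y_p; split=> //.
by rewrite -[wpow v n.+1]/(v ++ wpow v n) apath_cat ?(size_apath v_x) // v_x x_p.
Qed.

(** Two loops inserted into a run through [p] would give [2 ^ n] runs on a word of length linear in
    [n], against the polynomial bound. *)
Lemma loop_unique p v s s' : trim A -> polynomially_ambiguous A ->
  apath p v s -> apath p v s' -> last p s = p -> last p s' = p -> s = s'.
Proof.
move=> A_trim [P boundP] v_s v_s' s_p s'_p; apply/eqP/negPn/negP => neq_ss'.
have [w [r [r_run r_p]]] := A_trim p.
case rE: (val r) (size_tuple r) r_p => [//|q0 t] _ r_p.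
have {r_p} : p \in q0 :: t by rewrite -rE.
move/splitPl => tP; case: tP rE => t1 t2 t1_p rE; move: r_run.
rewrite (is_run_cons rE) last_cat t1_p => /and3P[w_t Iq0 Ft].
have sz_t : size (t1 ++ t2) = size w := size_apath w_t.
have le_t1 : (size t1 <= size w)%N by rewrite -sz_t size_cat leq_addr.
set w1 := take (size t1) w; set w2 := drop (size t1) w.
have sz_w1 : size t1 = size w1 by rewrite size_takel.
rewrite -[w](cat_take_drop (size t1)) apath_cat // t1_p in w_t.
have /andP[w1_t1 w2_t2] := w_t.
pose P' := P \Po ((size w)%:R%:P + (size v)%:R *: 'X).
have [n] := poly_lt_exp2 P'; apply/negP; rewrite -leNgt.
have [L [L_uniq L_sz L_loop]] := wpow_loops n v_s v_s' s_p s'_p neq_ss'.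
rewrite horner_comp hornerD hornerC hornerZ hornerX -natrM -natrD.
have <- : size (w1 ++ wpow v n ++ w2) = (size w + size v * n)%N.
  rewrite !size_cat addnCA addnC -size_cat cat_take_drop; congr (_ + _)%N.
  by rewrite /wpow size_flatten /shape map_nseq sumn_nseq.
apply: le_trans (boundP _); rewrite ler_nat -L_sz -(size_map (fun x => q0 :: t1 ++ x ++ t2)).
apply: nb_runs_ge => [|_ /mapP[x /L_loop[v_x x_p] ->]].
  rewrite map_inj_in_uniq // => x y /L_loop[v_x _] /L_loop[v_y _] [] /eqP.
  by rewrite eqseq_cat // eqxx /= eqseq_cat ?(size_apath v_x) ?(size_apath v_y) // => /andP[/eqP].
exists q0, (t1 ++ x ++ t2); split=> //; last by rewrite !last_cat t1_p x_p.
by rewrite !apath_cat ?(size_apath v_x) // w1_t1 t1_p v_x x_p.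
Qed.

(* If [p] and [q] lie on a common cycle of the support, then reading [v] twice admits
   two loops on [p], one through [p] and one through [q]. *)
Lemma wmat_p_triangular v : nonneg_trans A -> trim A -> polynomially_ambiguous A ->
  (forall p q r, wmat A v p q != 0 -> wmat A v q r != 0 -> wmat A v p r != 0) ->
  p_triangular (wmat A v).
Proof.
move=> A_ge0 A_trim A_poly v_trans.
apply: p_triangular_of_order => // p q v_pq v_qp.
have [s v_s s_q] := apath_of_wmat v_pq; have [s' v_s' s'_p] := apath_of_wmat v_qp.
have [t v_t t_p] := apath_of_wmat (v_trans _ _ _ v_pq v_qp).
have := @loop_unique p (v ++ v) (s ++ s') (t ++ t) A_trim A_poly.
rewrite !last_cat !apath_cat ?(size_apath v_s) ?(size_apath v_t) //.
rewrite v_s v_t s_q t_p s'_p v_s' v_t => /(_ isT isT erefl t_p)/eqP.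
rewrite eqseq_cat ?(size_apath v_s) ?(size_apath v_t) // => /andP[/eqP s_t _].
by rewrite -s_q s_t t_p.
Qed.

(** The colour of a word in the Ramsey argument. *)
Definition wsupp v : {set Q * Q} := [set pq | wmat A v pq.1 pq.2 != 0].

Lemma wsupp_p_triangular v v' : nonneg_trans A -> trim A -> polynomially_ambiguous A ->
  wsupp v = wsupp v' -> wsupp (v ++ v') = wsupp v -> p_triangular (wmat A v).
Proof.
move=> A_ge0 A_trim A_poly /setP eq_v /setP eq_vv'; apply: wmat_p_triangular => // p q r v_pq.
have := eq_v (q, r); rewrite !inE /= => ->.
by move=> v'_qr; have := eq_vv' (p, r); rewrite !inE /= => <-; apply: wmat_cat_neq0 v'_qr.
Qed.

Lemma wvalueE w : (wa_init A)^T *m wmat A w *m wa_final A = (wvalue A w)%:M.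
Proof. exact: mx11_scalar. Qed.
End Paths.
(** * From lines to automata *)

Lemma last_scanl (T1 T2 : Type) (h : T1 -> T2 -> T1) x y : last x (scanl h x y) = foldl h x y.
Proof. by elim: y x => //= a y IHy x; rewrite IHy. Qed.

Section MachineAutomaton.
Variables (Sigma G : finType) (pi : G -> Sigma) (r : nat) (i0 : 'I_r).
Variables (del : 'I_r -> G -> 'I_r) (s : 'I_r -> G -> rat) (t : rat) (b : 'I_r -> rat).

(** Letters of [G] are read through [pi], which is the identity in the blindly pumpable case and
    forgets annotations in the pumpable one. *)
Definition machine_wa : wautomaton Sigma :=
  WAutomaton (leq_ltn_trans (leq0n i0) (ltn_ord i0))
    (fun a => \matrix_(p, q) \sum_(x | pi x == a) s p x *+ (del p x == q))
    (\col_p (t *+ (p == i0))) (\col_p b p).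

Fixpoint lifts (w : seq Sigma) : seq (seq G) :=
  if w is a :: w' then [seq x :: y | x <- enum [pred x | pi x == a], y <- lifts w']
  else [:: [::]].

Lemma machine_wa_value w : wvalue machine_wa w =
  \sum_(y <- lifts w) t * run_weight del s i0 y * b (foldl del i0 y).
Proof.
have wF p : (wmat machine_wa w *m wa_final machine_wa) p 0 =
    \sum_(y <- lifts w) run_weight del s p y * b (foldl del p y).
  elim: w p => [|a w IHw] p; first by rewrite wmat_nil mul1mx mxE big_seq1 mul1r.
  rewrite wmat_cons -mulmxA mxE big_allpairs_dep /= big_enum /=.
  under eq_bigr => q _ do rewrite IHw mxE mulr_suml.
  rewrite exchange_big; apply: eq_big => [x|x _]; first by rewrite inE.
  rewrite (bigD1 (del p x)) //= eqxx [X in _ + X]big1 ?addr0 => [|q /negPf].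
    by rewrite mulr_sumr; apply: eq_bigr => y _; rewrite mulrA.
  by rewrite eq_sym => ->; rewrite mul0r.
rewrite /wvalue -mulmxA mxE (bigD1 i0) //= big1 => [|p /negPf p_i0].
  by rewrite addr0 wF !mxE eqxx mulr_sumr; apply: eq_bigr => y _; rewrite mulrA.
by rewrite !mxE p_i0 mul0r.
Qed.

(** A nonzero transition is a sum over letters with the same image under [pi], so one of its terms
    is nonzero and provides the lifted letter. *)
Lemma machine_wa_path p w qs : apath (A := machine_wa) p w qs ->
  exists y, [/\ map pi y = w, run_weight del s p y != 0 & qs = scanl del p y].
Proof.
elim: w p qs => [|a w IHw] p [|q qs] //=; first by exists [::].
case/andP => pq_n0 /IHw[y [<- y_n0 ->]].
have [x] : exists x, (pi x == a) && (s p x *+ (del p x == q) != 0).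
  apply/existsP; apply: contraNT pq_n0 => /existsPn all0.
  rewrite mxE big1 // => x /eqP pix; apply/eqP; have := all0 x.
  by rewrite pix eqxx negbK.
case: (eqVneq (del p x) q) => [xq|_] /andP[/eqP<-]; last by rewrite eqxx.
by move=> x_n0; exists (x :: y); rewrite /= xq mulf_neq0.
Qed.

Lemma machine_wa_unambiguous :
  (forall y z, map pi y = map pi z -> t * run_weight del s i0 y * b (foldl del i0 y) != 0 ->
    t * run_weight del s i0 z * b (foldl del i0 z) != 0 -> y = z) ->
  unambiguous machine_wa.
Proof.
move=> value_inj w; have runP (q : (size w).+1.-tuple 'I_r) : is_run (A := machine_wa) q ->
    exists y, [/\ map pi y = w, t * run_weight del s i0 y * b (foldl del i0 y) != 0
      & val q = i0 :: scanl del i0 y].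
  move: (size_tuple q); case qE: (tval q) => [//|p qs] _.
  rewrite (@is_run_cons _ machine_wa w q p qs qE) => /and3P[/machine_wa_path[y [yw y_n0 qsE]]].
  rewrite !mxE; case: (eqVneq p i0) => [p_i0 | _]; last by rewrite eqxx.
  rewrite p_i0 in y_n0 qE qsE *; rewrite qsE last_scanl in qE * => t_n0 b_n0.
  by exists y; split; [| rewrite !mulf_neq0 | exact: qE].
apply: (introT card_le1_eqP) => q q'; rewrite !inE.
move=> /runP[y [yw y_n0 qE]] /runP[z [zw z_n0 q'E]].
by apply: val_inj; rewrite qE q'E (value_inj y z) // yw zw.
Qed.
End MachineAutomaton.

Lemma machine_wa_deterministic (S : finType) r (i0 : 'I_r) (del : 'I_r -> S -> 'I_r) s t b :
  deterministic (machine_wa id i0 del s t b).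
Proof.
split=> [|a p]; apply/card_le1_eqP => q q'; rewrite !inE !mxE.
  by do 2![case: (eqVneq _ i0) => [->|_]; last by rewrite eqxx].
rewrite !big_pred1_eq.
by do 2![case: (eqVneq (del p a) _) => [<-|_]; last by rewrite eqxx].
Qed.

(** * The blindly pumpable case *)

Lemma map_wpow (S T : finType) (h : S -> T) v n : map h (wpow v n) = wpow (map h v) n.
Proof. by rewrite /wpow map_flatten map_nseq. Qed.

Section RowAction.
Variables (Sigma : finType) (A : wautomaton Sigma).

Lemma act_row w (x : 'rV_(wa_size A)) :
  act (fun a => linfun (mulmxr (wa_trans A a))) w x = x *m wmat A w.
Proof.
elim: w x => [|a w IHw] x /=; first by rewrite id_lfunE wmat_nil mulmx1.
by rewrite comp_lfunE lfunE /= IHw wmat_cons mulmxA.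
Qed.

Lemma act_col w (y : 'cV_(wa_size A)) :
  act (fun a => linfun (mulmx (wa_trans A a))) (rev w) y = wmat A w *m y.
Proof.
elim: w y => [|a w IHw] y /=; first by rewrite id_lfunE wmat_nil mul1mx.
by rewrite rev_cons -cats1 act_catE IHw /= comp_lfun1l lfunE /= wmat_cons mulmxA.
Qed.
End RowAction.

(** The row orbit of [wa_init A] is fed to [pumping_machine], with words coloured by their supports;
    the diagonal entries of [wmat A v] are the finite list of scalars valid for every prefix. *)
Lemma blindly_pumpable_determinisable (Sigma : finType) (A : wautomaton Sigma) :
  nonneg_trans A -> trim A -> polynomially_ambiguous A ->
  blindly_pumpable A -> determinisable A.
Proof.
move=> A_ge0 A_trim A_poly A_pump.
pose f : 'Hom('rV[rat]_(wa_size A), 'M[rat]_1) := linfun (mulmxr (wa_final A)).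
pose g a : 'End('rV[rat]_(wa_size A)) := linfun (mulmxr (wa_trans A a)).
have fE w : f (act g w (wa_init A)^T) = (wvalue A w)%:M.
  by rewrite lfunE /= act_row wvalueE.
have [|r [i0 [del [s [t [b bE]]]]]] :=
    @pumping_machine _ _ _ _ g (wa_init A)^T (wsupp A) (wa_size A) _ f.
  move=> v v' _ vv' v_vv'; exists [seq wmat A v i i | i <- enum 'I_(wa_size A)] => u.
  have [i iP] := A_pump u v (wsupp_p_triangular A_ge0 A_trim A_poly vv' v_vv').
  exists (wmat A v i i); first by apply/mapP; exists i; rewrite ?mem_enum.
  by move=> w; rewrite !fE -(addn1 (wa_size A)) iP expr1 scale_scalar_mx.
exists (machine_wa id i0 del s t (fun i => b i 0 0)); split.
  exact: machine_wa_deterministic.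
move=> w; rewrite machine_wa_value.
have -> : lifts id w = [:: w].
  by elim: w => //= a w ->; rewrite (eq_enum (B := pred1 a)) ?enum1.
have := congr1 (fun M : 'M_1 => M 0 0) (bE w).
by rewrite fE !mxE eqxx mulr1n big_seq1.
Qed.

(** * Annotation by the right hull *)

Section Annotation.
Variables (Sigma : finType) (A : wautomaton Sigma).
Hypotheses (A_ge0 : nonneg_trans A) (A_trim : trim A) (A_poly : polynomially_ambiguous A).
Hypothesis A_pump : pumpable A.
Local Notation n := (wa_size A).

Variables (r : nat) (Z : 'I_r -> {vspace 'cV[rat]_n}) (j0 : 'I_r).
Variable del : 'I_r -> Sigma -> 'I_r.
Let gcol a : 'End('cV[rat]_n) := linfun (mulmx (wa_trans A a)).
Hypothesis ZF : wa_final A \in Z j0.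
Hypothesis Zdel : forall j a, (gcol a @: Z j <= Z (del j a))%VS.
Hypothesis Zdense : forall j, dense (in_orbit gcol (wa_final A)) (Z j).

(** Computed from right to left because letters multiply columns on the left; from [j0] it leads to
    a component containing [wmat A w *m wa_final A]. *)
Definition rho (j : 'I_r) (w : seq Sigma) : 'I_r := foldr (fun a k => del k a) j w.

Lemma rho_cat j u w : rho j (u ++ w) = rho (rho j w) u.
Proof. exact: foldr_cat. Qed.

Lemma rho_hull w : wmat A w *m wa_final A \in Z (rho j0 w).
Proof.
elim: w => [|a w IHw] /=; first by rewrite wmat_nil mul1mx.
rewrite wmat_cons -mulmxA; apply: subvP (Zdel _ _) _ _.
by have := memv_img (gcol a) IHw; rewrite lfunE.
Qed.

(** For fixed [u] and [v], the columns that satisfy the equation with the entry [i] form a subspace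
    [U i]. By pumpability these cover the column orbit, so density puts all of [Z j] in one of
    them. *)
Lemma uniform_pump u v j : p_triangular (wmat A v) ->
  exists i, forall w, rho j0 w = j ->
    wvalue A (u ++ wpow v n.+1 ++ w) = wmat A v i i * wvalue A (u ++ wpow v n ++ w).
Proof.
move=> v_tri; pose x k := (wa_init A)^T *m wmat A (u ++ wpow v k).
pose U i := lker (linfun (mulmx (x n.+1 - wmat A v i i *: x n)) : 'Hom('cV[rat]_n, 'M[rat]_1)).
have UP i w : (wmat A w *m wa_final A \in U i) =
    (wvalue A (u ++ wpow v n.+1 ++ w) == wmat A v i i * wvalue A (u ++ wpow v n ++ w)).
  have valE k : wvalue A (u ++ wpow v k ++ w) = (x k *m (wmat A w *m wa_final A)) 0 0.
    by rewrite /wvalue catA wmat_cat !mulmxA.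
  rewrite memv_ker lfunE /= mulmxBl -scalemxAl subr_eq0 !valE.
  apply/eqP/eqP => [->|eq00]; first by rewrite [LHS]mxE.
  by apply/matrixP => p q; rewrite !ord1 eq00 [RHS]mxE.
have [|_ /mapP[i _ ->] /subvP ZU] := @Zdense j [seq U i | i <- enum 'I_n].
  move=> _ [w ->] _; rewrite -[w]revK act_col.
  have [i iP] := A_pump u (rev w) v_tri; exists (U i); first by rewrite map_f ?mem_enum.
  by rewrite UP -(addn1 n) iP.
by exists i => w wj; apply/eqP; rewrite -UP ZU // -wj rho_hull.
Qed.

Local Notation G := (Sigma * 'I_r)%type.
Local Notation pr := (map (@fst Sigma 'I_r)).

(* The letter [(a, k)] announces that the rest of the word leads backwards from
   [j] to [k]. *)
Fixpoint annotated (j : 'I_r) (w : seq G) : bool :=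
  if w is (a, k) :: w' then (k == rho j (pr w')) && annotated j w' else true.

Lemma annotated_cat j u w :
  annotated j (u ++ w) = annotated (rho j (pr w)) u && annotated j w.
Proof. by elim: u => //= -[a k] u ->; rewrite map_cat rho_cat andbA. Qed.

Lemma annotated_end j k w : w != [::] -> annotated j w -> annotated k w -> j = k.
Proof.
case/lastP: w => // w [a l] _; rewrite -cats1 !annotated_cat /= !andbT.
by move=> /andP[_ /eqP<-] /andP[_ /eqP].
Qed.

Lemma annotated_inj j w w' : annotated j w -> annotated j w' -> pr w = pr w' -> w = w'.
Proof.
elim: w w' => [|[a k] w IHw] [|[a' k'] w'] //= /andP[/eqP-> jw] /andP[/eqP-> jw'].
by case=> -> ww'; rewrite (IHw _ jw jw' ww').
Qed.

(** The right-hand side does not involve [M], so pumping preserves correctness. The last letter of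
    [v] fixes the component that must follow, which is [k]. *)
Lemma annotated_wpow j u v w k M : v != [::] -> annotated k v -> rho k (pr v) = k ->
  annotated j (u ++ wpow v M.+1 ++ w) =
  [&& rho j (pr w) == k, annotated k u & annotated j w].
Proof.
move=> v_n0 kv kvk; have rho_pow N : rho k (pr (wpow v N)) = k.
  by elim: N => // N IHN; rewrite wpowSr map_cat rho_cat kvk.
have pow_k N : annotated k (wpow v N).
  by elim: N => // N IHN; rewrite wpowSr annotated_cat kvk IHN.
rewrite catA annotated_cat [RHS]andbA; congr (_ && _).
apply/idP/andP => [|[/eqP-> ku]]; last by rewrite annotated_cat rho_pow ku pow_k.
rewrite annotated_cat {2}wpowSr annotated_cat => /and3P[ku _ wv].
have kw := annotated_end v_n0 wv kv; rewrite kw eqxx; split=> //.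
by move: ku; rewrite kw rho_pow.
Qed.

Local Notation V := {ffun 'I_r -> 'rV[rat]_n}.

(* In the state [X], the component [X k] is the row vector reached by the words whose
   last annotation is [k]; initially every [k] is possible. *)
Definition annot_step (x : G) (X : V) : V :=
  [ffun k => if k == x.2 then X (del x.2 x.1) *m wa_trans A x.1 else 0].

Lemma annot_step_linear x : linear (annot_step x).
Proof.
move=> k X Y; apply/ffunP => i; rewrite !ffunE; case: eqP => _.
  by rewrite mulmxDl scalemxAl.
by rewrite scaler0 addr0.
Qed.
HB.instance Definition _ x :=
  GRing.isLinear.Build rat V V *:%R (annot_step x) (annot_step_linear x).

Definition annot_out (X : V) : 'M[rat]_1 := X j0 *m wa_final A.

Lemma annot_out_linear : linear annot_out.
Proof. by move=> k X Y; rewrite /annot_out !ffunE mulmxDl scalemxAl. Qed.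
HB.instance Definition _ :=
  GRing.isLinear.Build rat V 'M[rat]_1 *:%R annot_out annot_out_linear.

Let g x : 'End(V) := linfun (annot_step x).
Let f : 'Hom(V, 'M[rat]_1) := linfun annot_out.
Let x0 : V := [ffun _ => (wa_init A)^T].

Lemma annot_value w : f (act g w x0) =
  if annotated j0 w then (wvalue A (pr w))%:M else 0.
Proof.
(* Reading the initial row as a component of [x0] lets the induction run over an arbitrary [X]. *)
rewrite -wvalueE; have <- : x0 (rho j0 (pr w)) = (wa_init A)^T by rewrite ffunE.
elim: w (x0) => [|[a k] w IHw] X /=.
  by rewrite id_lfunE lfunE /= wmat_nil mulmx1.
rewrite comp_lfunE IHw lfunE /= ffunE /= eq_sym.
case: (eqVneq k) => [->|_] /=; last by rewrite !mul0mx if_same.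
by case: ifP => // _; rewrite wmat_cons !mulmxA.
Qed.

Lemma annot_pump v v' : v != [::] -> wsupp A (pr v) = wsupp A (pr v') ->
    wsupp A (pr (v ++ v')) = wsupp A (pr v) ->
  exists ds : seq rat, forall u, exists2 d, d \in ds & forall w,
    f (act g (u ++ wpow v n.+1 ++ w) x0) = d *: f (act g (u ++ wpow v n ++ w) x0).
Proof.
rewrite map_cat => v_n0 vv' v_vv'.
have v_tri := wsupp_p_triangular A_ge0 A_trim A_poly vv' v_vv'.
(* The scalar 0 serves the prefixes [u] that no [w] completes to a correct annotation. *)
exists (0 :: [seq wmat A (pr v) i i | i <- enum 'I_n]) => u.
have [[w w_ann]|none] := classic (exists w, annotated j0 (u ++ wpow v n.+1 ++ w)); last first.
  exists 0; rewrite ?mem_head // => w; rewrite annot_value scale0r.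
  by case: ifP => // w_ann; case: none; exists w.
(* As [n > 0], the power contains two consecutive copies of [v]; both are correctly annotated, so
   the components after them agree. *)
have [k [kv kvk]] : exists k, annotated k v /\ rho k (pr v) = k.
  move: w_ann; rewrite -(prednK (wa_size_gt0 A)) !wpowSr -!catA !annotated_cat !map_cat !rho_cat.
  case/and5P => _ _ v1 v2 _; exists (rho j0 (pr w)); split=> //.
  exact: annotated_end v_n0 v1 v2.
have [i iP] := uniform_pump (pr u) k v_tri.
exists (wmat A (pr v) i i).
  by rewrite inE; apply/orP; right; apply/mapP; exists i; rewrite ?mem_enum.
move=> w'; rewrite !annot_value.
have -> : annotated j0 (u ++ wpow v n ++ w') = annotated j0 (u ++ wpow v n.+1 ++ w').
  by rewrite -(prednK (wa_size_gt0 A)) !(annotated_wpow _ _ _ _ v_n0 kv kvk).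
rewrite (annotated_wpow _ _ _ _ v_n0 kv kvk).
case: ifP => [/and3P[/eqP w'k _ _]|_]; last by rewrite scaler0.
by rewrite !map_cat !map_wpow iP // scale_scalar_mx.
Qed.

(** Exactly one lift of [w] is correctly annotated, and the others contribute 0. *)
Lemma sum_lifts_annotated w : \sum_(y <- lifts fst w) f (act g y x0) = (wvalue A w)%:M.
Proof.
have pr_lifts y : y \in lifts fst w -> pr y = w.
  elim: w y => [|a w IHw] y /=; first by rewrite inE => /eqP->.
  by case/allpairsP => -[x z] [/= + /IHw <- ->]; rewrite mem_enum => /eqP<-.
have [y [wy y_ann y_uniq]] : exists y : seq G,
    [/\ y \in lifts (@fst Sigma 'I_r) w, annotated j0 y
      & uniq (lifts (@fst Sigma 'I_r) w)].
  elim: w {pr_lifts} => [|a w [y [wy y_ann w_uniq]]]; first by exists [::].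
  exists ((a, rho j0 (pr y)) :: y); rewrite /= eqxx y_ann; split=> //.
    by apply/allpairsP; exists ((a, rho j0 (pr y)), y); rewrite mem_enum inE eqxx.
  by apply: allpairs_uniq => // [|[? ?] [? ?] _ _ [-> ->]]; rewrite ?enum_uniq.
rewrite (bigD1_seq y) //= big_seq_cond big1 ?addr0 => [|z /andP[wz neq_zy]].
  by rewrite annot_value y_ann pr_lifts.
rewrite annot_value; case: ifP => // z_ann; case/eqP: neq_zy.
by apply: annotated_inj z_ann y_ann _; rewrite !pr_lifts.
Qed.

(** A nonzero value forces a correct annotation, and the erased word determines it; this is the
    injectivity required by [machine_wa_unambiguous]. *)
Lemma annotated_unambiguisable : unambiguisable A.
Proof.
have [s [i0 [d [wt [t [b bE]]]]]] :=
  @pumping_machine _ _ _ _ g x0 (fun v => wsupp A (pr v)) n _ f annot_pump.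
have bE00 y : t * run_weight d wt i0 y * b (foldl d i0 y) 0 0 = f (act g y x0) 0 0.
  by rewrite bE mxE.
exists (machine_wa fst i0 d wt t (fun i => b i 0 0)); split.
  have ann_n0 y : f (act g y x0) 0 0 != 0 -> annotated j0 y.
    by rewrite annot_value; case: ifP => //; rewrite mxE eqxx.
  apply: machine_wa_unambiguous => y z yz; rewrite !bE00 => /ann_n0 y_ann /ann_n0 z_ann.
  exact: annotated_inj y_ann z_ann yz.
move=> w; rewrite machine_wa_value; under eq_bigr => y _ do rewrite bE00.
by rewrite -summxE sum_lifts_annotated mxE eqxx.
Qed.
End Annotation.

Lemma pumpable_unambiguisable (Sigma : finType) (A : wautomaton Sigma) :
  nonneg_trans A -> trim A -> polynomially_ambiguous A ->
  pumpable A -> unambiguisable A.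
Proof.
move=> A_ge0 A_trim A_poly A_pump.
have [r [Z [j0 [del [ZF Zdel Zdense]]]]] :=
  orbit_hull (fun a => linfun (mulmx (wa_trans A a))) (wa_final A).
exact: (annotated_unambiguisable A_ge0 A_trim A_poly A_pump ZF Zdel Zdense).
Qed.

Theorem proposition11 (Sigma : finType) (A : wautomaton Sigma)
    (hint : integral A) (hnonneg : nonneg_trans A) (htrim : trim A)
    (hpoly : polynomially_ambiguous A) :
  (pumpable A -> unambiguisable A) /\
  (blindly_pumpable A -> determinisable A).
Proof.
by split=> ?; [apply: pumpable_unambiguisable | apply: blindly_pumpable_determinisable].
Qed.
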